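(* Let $\mathcal{P}$ be a statistical model on $Z^\infty$ equipped with an ATTS sequence of statistics $S_n: Z^n \to \Sigma_n$, $n=1,2,\ldots$, and let $(A_n)$ be a nonconformity measure. Suppose that the sequence of observations $(\zeta_1,\zeta_2,\ldots)\in Z^\infty$ is generated from a probability distribution $P\in\mathcal{P}$ and that the random numbers $(\tau_1,\tau_2,\ldots)\sim U^\infty$ are independent of the observations. Then the p-values $p_n = p_n(\zeta_1,\ldots,\zeta_n,\tau_n)$, $n=1,2,\ldots$, are independent and distributed uniformly on $[0,1]$: $$(p_1,p_2,\ldots)\sim U^\infty.$$
   Context: $Z$ (the observation space) is a measurable space assumed to be Luzin, so that regular conditional probabilities exist. A statistical model $\mathcal{P}$ on $Z^\infty$ is a family of probability distributions on $Z^\infty$. $U$ is the uniform distribution on $[0,1]$, and $U^\infty$ is the distribution of an infinite sequence of independent $U$-distributed random variables. Let $S_n: Z^n\to\Sigma_n$, $n=1,2,\ldots$, be statistics (measurable maps into measurable spaces) with $\Sigma_n=S_n(Z^n)$. The sequence $(S_n)$ is algebraically transitive if there are measurable functions $F_n:\Sigma_{n-1}\times Z\to\Sigma_n$, $n=2,3,\ldots$, such that $S_n(\zeta_1,\ldots,\zeta_n)=F_n(S_{n-1}(\zeta_1,\ldots,\zeta_{n-1}),\zeta_n)$ for all $(\zeta_1,\ldots,\zeta_n)\in Z^n$. It is totally sufficient for $\mathcal{P}$ if, for each $n=1,2,\ldots$: (i) $S_n$ is sufficient for $\mathcal{P}$; (ii) for any $P\in\mathcal{P}$, if $(\zeta_1,\zeta_2,\ldots)\sim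 P$, then $(\zeta_1,\ldots,\zeta_n)$ and $(\zeta_{n+1},\zeta_{n+2},\ldots)$ are conditionally independent given $S_n(\zeta_1,\ldots,\zeta_n)$. An ATTS sequence is a sequence of statistics that is both algebraically transitive and totally sufficient for $\mathcal{P}$. Let $\Sigma_0$ be a fixed one-element set ($S_0$ of the empty sequence is its element). A nonconformity measure is any sequence of measurable functions $A_n:\Sigma_{n-1}\times Z\to\mathbb{R}$, $n=1,2,\ldots$. Given a nonconformity measure, $\zeta_1,\zeta_2,\ldots\in Z$ and $\tau_1,\tau_2,\ldots\in[0,1]$, the p-values are $$p_n=p_n(\zeta_1,\ldots,\zeta_n,\tau_n):=\mathbb{P}(A_n^{\mathrm{rnd}}>A_n^{\mathrm{obs}}\mid S_n^{\mathrm{rnd}}=S_n^{\mathrm{obs}})+\tau_n\,\mathbb{P}(A_n^{\mathrm{rnd}}=A_n^{\mathrm{obs}}\mid S_n^{\mathrm{rnd}}=S_n^{\mathrm{obs}}),$$ where $A_n^{\mathrm{rnd}}:=A_n(S_{n-1}(\xi_1,\ldots,\xi_{n-1}),\xi_n)$, $S_n^{\mathrm{rnd}}:=S_n(\xi_1,\ldots,\xi_n)$, $A_n^{\mathrm{obs}}:=A_n(S_{n-1}(\zeta_1,\ldots,\zeta_{n-1}),\zeta_n)$, $S_n^{\mathrm{obs}}:=S_n(\zeta_1,\ldots,\zeta_n)$; here the $\zeta_i$ (and hence the ''obs'' values) are treated as fixed, and the probabilities are over $(\xi_1,\xi_2,\ldots)\sim P$ for some $P\in\mathcal{P}$. Since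 $S_n$ is sufficient, the regular conditional probabilities are chosen so that $p_n$ does not depend on $P\in\mathcal{P}$. *)

(* Defs.v *)
From HB Require Import structures.
From mathcomp Require Import all_boot all_order all_algebra finmap.
From mathcomp Require Import all_classical all_reals all_analysis.
Import Order.TTheory GRing.Theory Num.Theory.
Import numFieldNormedType.Exports.

Set Implicit Arguments.
Unset Strict Implicit.
Unset Printing Implicit Defensive.

Local Open Scope classical_set_scope.
Local Open Scope ring_scope.

(* Sequences are indexed from 0: the observation zeta_(i+1) is [z i], and
   (zeta_1, ..., zeta_n) is the tuple [init_seg n z]. *)

Definition cylinders d (Z : measurableType d) : set (set (nat -> Z)) :=
  [set E | exists i (B : set Z), measurable B /\ E = [set z | B (z i)]].

(* Z^oo with the product sigma-algebra. *)
Definition seqspace d (Z : measurableType d) :=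
  g_sigma_algebraType (@cylinders d Z).

Definition init_seg d (Z : measurableType d) n (z : seqspace Z) : n.-tuple Z :=
  [tuple z (val i) | i < n].

Definition tail_seq d (Z : measurableType d) n (z : seqspace Z) : seqspace Z :=
  fun i => z (n + i)%N.

Definition butlast (T : Type) n (x : n.+1.-tuple T) : n.-tuple T :=
  [tuple tnth x (widen_ord (leqnSn n) i) | i < n].

(* Isomorphic to a Borel subset H of a compact metrizable space: here
   H = range f, and the last clause says that f carries the sigma-algebra
   of Z to the trace on H of the Borel sigma-algebra of M. *)
Definition luzin (R : realType) d (Z : measurableType d) : Prop :=
  exists (M : metricType R) (f : Z -> M),
    [/\ compact [set: M], injective f,
        <<s [set V : set M | open V] >> (range f) &
        forall A : set Z, measurable A <->
          exists2 B : set M, <<s [set V : set M | open V] >> B & A = f @^-1` B].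

Section conditioning.
Context (R : realType) d (X : measurableType d) (mu : probability X R).

(* [g \o T] is a version of the conditional probability mu(E | T). *)
Definition cond_prob d' (Y : measurableType d') (T : X -> Y) (E : set X)
    (g : Y -> R) : Prop :=
  [/\ measurable_fun setT g,
      mu.-integrable setT (fun x => (g (T x))%:E) &
      forall C : set Y, measurable C ->
        (\int[mu]_(x in T @^-1` C) (g (T x))%:E = mu (E `&` T @^-1` C))%E].

(* K is a regular conditional distribution of V given T. *)
Definition regular_cond_distr d' (Y : measurableType d') d''
    (W : measurableType d'') (T : X -> Y) (V : X -> W)
    (K : R.-pker Y ~> W) : Prop :=
  forall B : set W, measurable B ->
    cond_prob T (V @^-1` B) (fun y => fine (K y B)).

(* Versions of conditional probabilities exist and are a.s. unique, so it is
   immaterial whether they are quantified existentially or universally. *)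
Definition cond_independent d' (Y : measurableType d')
    d1 (W1 : measurableType d1) d2 (W2 : measurableType d2)
    (T : X -> Y) (V1 : X -> W1) (V2 : X -> W2) : Prop :=
  forall (B1 : set W1) (B2 : set W2), measurable B1 -> measurable B2 ->
  exists g1 g2 g12 : Y -> R,
    [/\ cond_prob T (V1 @^-1` B1) g1,
        cond_prob T (V2 @^-1` B2) g2,
        cond_prob T (V1 @^-1` B1 `&` V2 @^-1` B2) g12 &
        {ae mu, forall x, g12 (T x) = g1 (T x) * g2 (T x)}].

Definition has_law d' (W : measurableType d') (V : X -> W)
    (nu : set W -> \bar R) : Prop :=
  measurable_fun setT V /\
  forall B : set W, measurable B -> mu (V @^-1` B) = nu B.

Definition independent2 d1 (W1 : measurableType d1) d2 (W2 : measurableType d2)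
    (V1 : X -> W1) (V2 : X -> W2) : Prop :=
  forall (B1 : set W1) (B2 : set W2), measurable B1 -> measurable B2 ->
    (mu (V1 @^-1` B1 `&` V2 @^-1` B2) = mu (V1 @^-1` B1) * mu (V2 @^-1` B2))%E.

Definition mutually_independent d' (W : measurableType d')
    (V : nat -> X -> W) : Prop :=
  forall (J : {fset nat}) (B : nat -> set W), (forall i, measurable (B i)) ->
    (mu (\bigcap_(i in [set` J]) (V i @^-1` B i)) =
     \prod_(i <- J) mu (V i @^-1` B i))%E.

(* V ~ U^oo *)
Definition Uinfty_distributed (V : X -> seqspace R) : Prop :=
  (forall n, has_law (fun x => V x n) (uniform_prob (@ltr01 R))) /\
  mutually_independent (fun n x => V x n).

End conditioning.

Section compression.
Context (R : realType) d (Z : measurableType d).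
Context (dS : nat -> measure_display) (Sigma : forall n, measurableType (dS n)).
Implicit Type Pm : set (probability (seqspace Z) R).
Implicit Type S : forall n, n.-tuple Z -> Sigma n.

(* Surjectivity for n = 0 makes [Sigma 0] a one-element set. *)
Definition statistics S : Prop :=
  forall n, measurable_fun setT (S n) /\ range (S n) = setT.

(* [F n] is the F_(n+1) of the usual numbering. *)
Definition algebraically_transitive S : Prop :=
  exists F : forall n, Sigma n * Z -> Sigma n.+1,
  forall n, (0 < n)%N ->
    measurable_fun setT (F n) /\
    forall (t : n.-tuple Z) (z : Z), S n.+1 [tuple of rcons t z] = F n (S n t, z).

(* The conditional probabilities given S_n of events in Z^n have versions
   common to all the members of the model. *)
Definition sufficient Pm S n : Prop :=
  forall B : set (n.-tuple Z), measurable B ->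
  exists g : Sigma n -> R, forall P, Pm P ->
    cond_prob P (fun z => S n (init_seg n z)) (@init_seg _ Z n @^-1` B) g.

Definition totally_sufficient Pm S : Prop :=
  forall n, (0 < n)%N ->
    sufficient Pm S n /\
    forall P, Pm P ->
      cond_independent P (fun z => S n (init_seg n z))
        (@init_seg _ Z n) (@tail_seq _ Z n).

Definition ATTS Pm S : Prop :=
  algebraically_transitive S /\ totally_sufficient Pm S.

(* K n s stands for the conditional distribution of (xi_1, ..., xi_n) given
   S_n = s, chosen to be the same for every P in the model. *)
Definition common_cond_distr Pm S (K : forall n, R.-pker Sigma n ~> n.-tuple Z)
    : Prop :=
  forall n, (0 < n)%N -> forall P, Pm P ->
    regular_cond_distr P (fun z => S n (init_seg n z)) (@init_seg _ Z n) (K n).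

(* [A n] is the A_(n+1) of the usual numbering. *)
Definition nonconformity_measure (A : forall n, Sigma n * Z -> R) : Prop :=
  forall n, measurable_fun setT (A n).

Definition nonconformity_score S (A : forall n, Sigma n * Z -> R) n
    (x : n.+1.-tuple Z) : R :=
  A n (S n (butlast x), tnth x ord_max).

(* The p-value p_(n+1)(zeta_1, ..., zeta_(n+1), tau_(n+1)). *)
Definition pvalue S (A : forall n, Sigma n * Z -> R)
    (K : forall n, R.-pker Sigma n ~> n.-tuple Z) n
    (zeta : n.+1.-tuple Z) (tau : R) : R :=
  let score := nonconformity_score S A (n := n) in
  fine (K n.+1 (S n.+1 zeta) [set xi | score xi > score zeta]) +
  tau * fine (K n.+1 (S n.+1 zeta) [set xi | score xi = score zeta]).

End compression.

(* Main.v *)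
Require Import Defs.
From HB Require Import structures.
From mathcomp Require Import all_boot all_order all_algebra finmap.
From mathcomp Require Import all_classical all_reals all_analysis.
From mathcomp Require Import measurable_realfun.
From mathcomp Require Import lra.
Import Order.TTheory GRing.Theory Num.Theory.
Import numFieldNormedType.Exports.

Set Implicit Arguments.
Unset Strict Implicit.
Unset Printing Implicit Defensive.

Local Open Scope classical_set_scope.
Local Open Scope ring_scope.

(** The p-value at time n is a randomized tail probability of the score under
    the conditional law of the first n observations given the summary S_n. For
    any fixed law, the tail probability of an observation drawn from that law,
    with a uniform randomization spread over the atom it falls in, is uniform on
    [0, 1] ([randomized_tail_uniform]); applied to the conditional laws it says
    that p_n is uniform given S_n ([conditionally_uniform]).

    Total sufficiency improves this. Given S_n, the first n observations are
    independent of the later ones, so conditioning also on the observations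
    after time n leaves the conditional law of the first n, and hence that of
    p_n, unchanged ([cond_independent_integral]). As tau_n is independent of the
    observations and of the later random numbers, p_n is uniform and independent
    of the state made of S_n, the observations after time n and the random
    numbers after time n ([pval_state_independent]).

    Algebraic transitivity gives the last step: S_(n+1), S_(n+2), etc. can be
    computed from S_n and the observations after time n, so all later p-values
    are functions of that state ([future_pvals_state]). Each p-value is therefore
    independent of all the later ones jointly, and peeling them off one at a time
    gives independence of the whole sequence ([pvals_block]).

    Conditioning is expressed by identities between finite measures. Such an
    identity needs checking on a pi-system only, in practice on measurable
    rectangles or on finite-dimensional boxes of sequences. *)

(** * Finite measures agreeing on a pi-system *)

Section pi_systems.
Local Open Scope ereal_scope.

Lemma finite_measure_eq_pi d (T : measurableType d) (R : realType)
    (G : set (set T)) (m1 m2 : {measure set T -> \bar R}) :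
  @measurable _ T = <<s G >> -> setI_closed G ->
  m1 setT = m2 setT -> m1 setT < +oo ->
  (forall A, G A -> m1 A = m2 A) ->
  forall A, measurable A -> m1 A = m2 A.
Proof.
move=> GE GI m12T m1T m12 A; rewrite GE.
have mG : G `<=` measurable by rewrite GE; exact: sub_gen_smallest.
have HG : [set X | G X /\ X `<=` setT] = G.
  by apply/seteqP; split => [X []//|X]; split.
move=> sA; apply: (g_sigma_algebra_measure_unique_trace G setT) => //;
  rewrite ?HG//.
Qed.

Lemma finite_measure_eq_rect d1 d2 (T1 : measurableType d1)
    (T2 : measurableType d2) (R : realType)
    (m1 m2 : {measure set (T1 * T2) -> \bar R}) :
  m1 setT < +oo ->
  (forall A B, measurable A -> measurable B -> m1 (A `*` B) = m2 (A `*` B)) ->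
  forall E, measurable E -> m1 E = m2 E.
Proof.
move=> m1T m12; apply: (finite_measure_eq_pi (measurable_prod_measurableType _ _)) => //.
- move=> _ _ [A mA [B mB <-]] [A' mA' [B' mB' <-]].
  by exists (A `&` A'); [exact: measurableI|exists (B `&` B');
    [exact: measurableI|rewrite setXI]].
- by rewrite -setXTT; exact: m12.
- by move=> _ [A mA [B mB <-]]; exact: m12.
Qed.

End pi_systems.

Section restricted_law.
Local Open Scope ereal_scope.
Context (R : realType) d (X : measurableType d) d' (Y : measurableType d').
Variable mu : {finite_measure set X -> \bar R}.

(** The law of V on the event A, not normalized. The measurability proofs are
    arguments so that the measure structure can be inferred. *)
Definition restricted_law (A : set X) (mA : measurable A) (V : X -> Y)
    (mV : measurable_fun setT V) (D : set Y) : \bar R :=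
  mu (A `&` V @^-1` D).

Variables (A : set X) (mA : measurable A) (V : X -> Y).
Variable mV : measurable_fun setT V.

Let nu := restricted_law mA mV.

Let mpre D : measurable D -> measurable (A `&` V @^-1` D).
Proof.
move=> mD; apply: measurableI => //.
by rewrite -[X in measurable X]setTI; exact: mV.
Qed.

Let nu0 : nu set0 = 0.
Proof. by rewrite /nu /restricted_law preimage_set0 setI0 measure0. Qed.

Let nu_ge0 D : 0 <= nu D. Proof. exact: measure_ge0. Qed.

Let nu_sigma_additive : semi_sigma_additive nu.
Proof.
move=> F mF tF mUF; rewrite /nu /restricted_law preimage_bigcup setI_bigcupr.
apply: measure_semi_sigma_additive.
- by move=> n; exact: mpre.
- apply/trivIsetP => /= i j _ _ ij; rewrite setIACA -preimage_setI.
  by move/trivIsetP : tF => /(_ _ _ _ _ ij) -> //; rewrite preimage_set0 setI0.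
- by rewrite -setI_bigcupr -preimage_bigcup; exact: mpre.
Qed.

HB.instance Definition _ := isMeasure.Build _ _ _ nu nu0 nu_ge0 nu_sigma_additive.

Let nu_fin : fin_num_fun nu.
Proof.
by move=> D mD; rewrite /nu /restricted_law fin_num_measure//; exact: mpre.
Qed.

HB.instance Definition _ := Measure_isFinite.Build _ _ _ nu nu_fin.

End restricted_law.

(** Two applications of the case of two factors, the constraint on the last
    coordinate being absorbed in the measures during the second one. *)
Lemma finite_measure_eq_rect3 (R : realType) d1 d2 d3 (T1 : measurableType d1)
    (T2 : measurableType d2) (T3 : measurableType d3)
    (m1 m2 : {finite_measure set ((T1 * T2) * T3)%type -> \bar R}) :
  (forall A B C, measurable A -> measurable B -> measurable C ->
    m1 ((A `*` B) `*` C) = m2 ((A `*` B) `*` C)) ->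
  forall E, measurable E -> m1 E = m2 E.
Proof.
move=> m12; apply: finite_measure_eq_rect; first by rewrite ltey_eq fin_num_measure.
move=> AB C mAB mC.
have mTC : measurable ([set: (T1 * T2)%type] `*` C) by exact: measurableX.
have rE D : D `*` C = ([set: (T1 * T2)%type] `*` C) `&` fst @^-1` D.
  by apply/seteqP; split => x /=; [case|case=> -[]].
rewrite rE; apply: (@finite_measure_eq_rect _ _ _ _ _
    (restricted_law m1 mTC measurable_fst) (restricted_law m2 mTC measurable_fst)) => //.
  by rewrite ltey_eq fin_num_measure.
by move=> A B mA mB; have := m12 A B C mA mB mC; rewrite (rE (A `*` B)).
Qed.

(** Independence spreads from a pi-system to the sigma-algebra it generates. For
    a probability and A' the full event, the conclusion is that A, of
    probability c, is independent of V. *)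
Lemma scaled_law_pi (R : realType) d (X : measurableType d)
    (mu : {finite_measure set X -> \bar R})
    d' (Y : measurableType d') (V : X -> Y) (G : set (set Y)) (A A' : set X)
    (c : {nonneg R}) :
  measurable_fun setT V -> measurable A -> measurable A' ->
  @measurable _ Y = <<s G >> -> setI_closed G ->
  (mu A = c%:num%:E * mu A')%E ->
  (forall D, G D ->
    mu (A `&` V @^-1` D) = c%:num%:E * mu (A' `&` V @^-1` D))%E ->
  forall D, measurable D ->
    (mu (A `&` V @^-1` D) = c%:num%:E * mu (A' `&` V @^-1` D))%E.
Proof.
move=> mV mA mA' GE GI AA' AD D mD.
apply: (@finite_measure_eq_pi _ _ _ _ (restricted_law mu mA mV)
  (mscale c (restricted_law mu mA' mV)) GE GI) => //=.
- by rewrite /mscale/= /restricted_law preimage_setT !setIT.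
- by rewrite ltey_eq fin_num_measure.
Qed.

Section finite_product.
Local Open Scope ereal_scope.
Context d1 d2 (T1 : measurableType d1) (T2 : measurableType d2) (R : realType).
Variables (m1 : {finite_measure set T1 -> \bar R}).
Variables (m2 : {finite_measure set T2 -> \bar R}).

(** The product measure under a head symbol of its own, to which the structure
    of finite measure can be attached. *)
Definition finite_product : set (T1 * T2) -> \bar R := m1 \x m2.

HB.instance Definition _ := Measure.on finite_product.

Let finite_product_fin : fin_num_fun finite_product.
Proof.
apply: lty_fin_num_fun; rewrite -setXTT [ltLHS]product_measure1E//.
by rewrite ltey_eq fin_numM// fin_num_measure.
Qed.

HB.instance Definition _ :=
  Measure_isFinite.Build _ _ _ finite_product finite_product_fin.

End finite_product.

(** * The uniform law and the randomized tail probability *)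

Section unif01.
Context {R : realType}.

(** The uniform law on [0, 1], as a probability for the canonical measurable
    structure of [R] rather than for the alias carrying [uniform_prob]. *)
Definition unif01 (D : set R) : \bar R := uniform_prob (@ltr01 R) D.

Let unif01_0 : unif01 set0 = 0%E. Proof. exact: measure0. Qed.

Let unif01_ge0 D : (0 <= unif01 D)%E. Proof. exact: measure_ge0. Qed.

Let unif01_sigma_additive : semi_sigma_additive unif01.
Proof. exact: (@measure_semi_sigma_additive _ _ _ (uniform_prob (@ltr01 R))). Qed.

HB.instance Definition _ := isMeasure.Build _ _ _ unif01
  unif01_0 unif01_ge0 unif01_sigma_additive.

Let unif01_setT : unif01 setT = 1%E. Proof. exact: probability_setT. Qed.

HB.instance Definition _ := Measure_isProbability.Build _ _ _ unif01 unif01_setT.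

End unif01.
Arguments unif01 R D : clear implicits.

Section uniform_law.
Context {R : realType}.
Local Notation U := (unif01 R).
Local Open Scope ereal_scope.

Lemma unif01_support (D : set R) : U D = U (D `&` `[0%R, 1%R]).
Proof.
rewrite /unif01 /uniform_prob [RHS]integral_uniform_pdf -setIA setIid.
by rewrite -integral_uniform_pdf.
Qed.

Lemma unif01_eq1 (D : set R) : measurable D -> `[0%R, 1%R] `<=` D -> U D = 1.
Proof. by move=> mD D01; rewrite /unif01 /uniform_prob integral_uniform_pdf1. Qed.

Lemma unif01_eq0 (D : set R) : D `&` `[0%R, 1%R] = set0 -> U D = 0.
Proof. by move=> D0; rewrite unif01_support D0 measure0. Qed.

Lemma unif01_ray (v : R) : (0 <= v <= 1)%R -> U `]-oo, v] = v%:E.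
Proof.
move=> /andP[v0 v1]; rewrite /unif01 /uniform_prob integral_uniform_pdf.
have -> : [set` `]-oo, v]] `&` [set` `[0%R, 1%R]] = [set` `[0%R, v]] :> set R.
  apply/seteqP; split => x /=; rewrite !in_itv/=; first by move=> [-> /andP[->]].
  by move=> /andP[-> xv]; split => //; rewrite (le_trans xv).
rewrite (eq_integral (cst 1)); last first.
  move=> x; rewrite inE/= in_itv/= => /andP[x0 xv].
  by rewrite /uniform_pdf x0 (le_trans xv)//= subr0 invr1.
rewrite integral_cst//= mul1e lebesgue_measure_itv/= lte_fin.
by case: ltP => [_|v0']; [rewrite sube0|congr EFin; apply/le_anti/andP].
Qed.

Lemma measurable_affine_le (p q u : R) : measurable [set t : R | (p + t * q <= u)%R].
Proof.
rewrite -[X in measurable X]setTI.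
have : measurable_fun setT (fun t : R => p + t * q)%R.
  by apply: measurable_funD => //; exact: measurable_funM.
by move=> /(_ measurableT `]-oo, u]%classic (measurable_itv _)); rewrite set_itvE.
Qed.

Lemma unif01_affine_le1 (p q u : R) : (0 <= q)%R -> (p + q <= u)%R ->
  U [set t | (p + t * q <= u)%R] = 1.
Proof.
move=> q0 pqu; apply: unif01_eq1; first exact: measurable_affine_le.
move=> t /=; rewrite in_itv/= => /andP[t0 t1].
by rewrite (le_trans _ pqu)// lerD2l ler_piMl.
Qed.

Lemma unif01_affine_le0 (p q u : R) : (0 <= q)%R -> (u < p)%R ->
  U [set t | (p + t * q <= u)%R] = 0.
Proof.
move=> q0 up; apply: unif01_eq0; apply/seteqP; split => // t /= [ptu].
rewrite in_itv/= => /andP[t0 _].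
have : (p <= p + t * q)%R by rewrite lerDl mulr_ge0.
by move=> /le_trans /(_ ptu); rewrite leNgt up.
Qed.

(** The equation is multiplied out by q so as to include q = 0, which is the
    case of an atom of mass zero below. *)
Lemma unif01_affine_le (p q u : R) : (p <= u <= p + q)%R ->
  q%:E * U [set t | (p + t * q <= u)%R] = (u - p)%:E.
Proof.
move=> /andP[pu upq]; have [q0|q0] := eqVneq q 0%R.
  by rewrite q0 mul0e; congr EFin; move: upq; rewrite q0; lra.
have q_gt0 : (0 < q)%R by rewrite lt_neqAle eq_sym q0/=; lra.
have -> : [set t | (p + t * q <= u)%R] = `]-oo, ((u - p) / q)%R]%classic.
  by apply/seteqP; split => t /=; rewrite in_itv/= ler_pdivlMr// lerBrDl.
rewrite unif01_ray -?EFinM; first by rewrite mulrC divfK.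
apply/andP; split; first by rewrite divr_ge0 ?subr_ge0// ltW.
by rewrite ler_pdivrMr// mul1r lerBlDl.
Qed.

End uniform_law.

Section quantile.
Context d (W : measurableType d) {R : realType} (mu : probability W R).
Variable X : {RV mu >-> R}.
Local Open Scope ereal_scope.

(** The survival function decreases from 1 to 0, so it crosses every level u
    in ]0, 1[. At the crossing point a, the least point where it is at most u,
    right continuity gives the upper bound, and continuity from above of [mu]
    along the events a - 1/n < X gives the lower one. *)
Lemma survival_crossing (u : R) : (0 < u < 1)%R ->
  exists a, ccdf X a <= u%:E <= mu [set w | (a <= X w)%R] /\
    forall b, (b < a)%R -> u%:E < ccdf X b.
Proof.
move=> /andP[u0 u1]; pose S := [set a | ccdf X a <= u%:E].
have [b Sb] : S !=set0.
  have : \forall x \near +oo%R, ccdf X x < u%:E.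
    have /(_ [set y | y < u%:E]) := cvg_ccdfy0 X; apply.
    by apply: open_ereal_lt'; rewrite lte_fin.
  move=> [M [_ /(_ (M + 1)%R)]]; rewrite ltrDl ltr01 => /(_ isT) /ltW.
  by exists (M + 1)%R.
have [l Sl] : has_lbound S.
  have : \forall x \near -oo%R, u%:E < ccdf X x.
    have /(_ [set y | u%:E < y]) := cvg_ccdfNy1 X; apply.
    by apply: open_ereal_gt'; rewrite lte_fin.
  move=> [M [_ HM]]; exists M => x Sx; rewrite leNgt; apply/negP => /HM.
  by rewrite ltNge Sx.
have hS : has_inf S by split; [exists b|exists l].
exists (inf S); split; last first.
  by move=> c cS; rewrite ltNge; apply/negP => /(ge_inf hS.2); rewrite leNgt cS.
apply/andP; split.
  have /cvge_to_le := @ccdf_right_continuous _ _ _ _ X (inf S); apply.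
  near=> x; have xS : (inf S < x)%R by near: x; exact: nbhs_right_gt.
  have [s Ss sx] : exists2 s, S s & (s < x)%R.
    have e0 : (0 < x - inf S)%R by rewrite subr_gt0.
    by have [s Ss] := inf_adherent e0 hS; rewrite addrC subrK => sx; exists s.
  exact: le_trans (ccdf_nonincreasing X (ltW sx)) Ss.
pose F n := [set w | (inf S - n.+1%:R^-1 < X w)%R].
have FE n : F n = X @^-1` `](inf S - n.+1%:R^-1)%R, +oo[%classic.
  by apply/seteqP; split => w /=; rewrite in_itv/= andbT.
have mF n : measurable (F n).
  by rewrite FE -[Y in measurable Y]setTI; exact: measurable_funP.
have capF : \bigcap_n F n = [set w | (inf S <= X w)%R].
  apply/seteqP; split => w /= wF; last first.
    by move=> n _; apply: lt_le_trans wF; rewrite ltrBlDr ltrDl.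
  rewrite leNgt; apply/negP => wS.
  have e0 : (0 < inf S - X w)%R by rewrite subr_gt0.
  have [n _ /(_ n (leqnn n)) /= hn] := near_infty_natSinv_lt (PosNum e0).
  have := wF n I; rewrite /F/= ltNge => /negP; apply.
  by rewrite lerBrDr -lerBrDl ltW.
rewrite -capF.
have : mu \o F @ \oo --> mu (\bigcap_n F n).
  apply: nonincreasing_cvg_mu => //.
  - by rewrite ltey_eq fin_num_measure.
  - by apply: bigcap_measurable.
  - move=> m n mn; apply/subsetPset => w /=; apply: le_lt_trans.
    by rewrite lerB// lef_pV2 ?posrE// ler_nat.
move/cvge_to_ge; apply; near=> n => /=.
have : ~ S (inf S - n.+1%:R^-1)%R.
  move=> /(ge_inf hS.2); rewrite lerBrDl gerDr => //.
  by rewrite leNgt invr_gt0 ltr0n.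
by move=> /negP; rewrite -ltNge /ccdf /distribution /pushforward -FE => /ltW.
Unshelve. all: by end_near. Qed.

End quantile.

Section randomized_pit.
Context d (W : measurableType d) {R : realType} (mu : probability W R).
Variable X : {RV mu >-> R}.
Local Notation U := (unif01 R).
Local Open Scope ereal_scope.

Let tail w := mu [set x | (X w < X x)%R].
Let atom w := mu [set x | X x = X w].

Definition randomized_tail (wt : W * R) : R :=
  (fine (tail wt.1) + wt.2 * fine (atom wt.1))%R.

Let tailE w : tail w = ccdf X (X w).
Proof.
by congr (mu _); apply/seteqP; split => x /=; rewrite in_itv/= andbT.
Qed.

Let preX (D : set R) : measurable D -> measurable (X @^-1` D).
Proof. by move=> mD; rewrite -[Y in measurable Y]setTI; exact: measurable_funP. Qed.

Let measurable_level a : measurable [set x | X x = a].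
Proof. exact: preX (measurable_set1 a). Qed.

Let measurable_upper a : measurable [set x | (a <= X x)%R].
Proof.
have -> : [set x | (a <= X x)%R] = X @^-1` `[a, +oo[%classic.
  by apply/seteqP; split => x /=; rewrite in_itv/= andbT.
exact: preX.
Qed.

Let ccdf_fin a : ccdf X a \is a fin_num.
Proof. by rewrite fin_num_measure//; exact: preX. Qed.

Let atom_fin a : mu [set x | X x = a] \is a fin_num.
Proof. by rewrite fin_num_measure. Qed.

Let upperE a : mu [set x | (a <= X x)%R] = ccdf X a + mu [set x | X x = a].
Proof.
rewrite /ccdf /distribution /pushforward -measureU//=; last 2 first.
- exact: preX.
- apply/seteqP; split => // x /= [+ xa]; rewrite xa in_itv/= ltxx//.
congr (mu _); apply/seteqP; split => x /=; rewrite in_itv/= andbT le_eqVlt.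
  by move=> /orP[/eqP ->|]; [right|left].
by case=> [->|->]; rewrite ?orbT// eqxx.
Qed.

Lemma measurable_randomized_tail : measurable_fun setT randomized_tail.
Proof.
have mtail : measurable_fun setT (fine \o tail).
  apply/measurableT_comp => //; rewrite (_ : tail = ccdf X \o X); last first.
    by apply/funext => w; exact: tailE.
  by apply/measurableT_comp => //; exact: ccdf_measurable.
have matom : measurable_fun setT (fine \o atom).
  apply/measurableT_comp => //.
  pose E := [set wx : W * W | X wx.2 = X wx.1].
  have mE : measurable E.
    have /(_ measurableT [set true] Logic.I) :
        measurable_fun setT (fun wx : W * W => X wx.2 == X wx.1).
      by apply: measurable_fun_eqr; exact: measurableT_comp.
    rewrite setTI; congr (measurable _).
    by apply/seteqP; split => x /= /eqP.
  have := measurable_fun_xsection mu mE; congr (measurable_fun _ _).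
  by apply/funext => w /=; congr (mu _); rewrite xsectionE.
apply: measurable_funD; first exact: (measurableT_comp mtail).
by apply: measurable_funM => //; exact: (measurableT_comp matom).
Qed.

(** Split at the crossing point a. An observation above a has a randomized tail
    at most u, and one below a has a randomized tail exceeding u, whatever the
    random number in [0, 1]. At a itself the random numbers giving at most u have
    a proportion which, multiplied by the mass of the atom, fills exactly the gap
    between the survival function at a and u. *)
Let cdf_randomized_tail01 (u : R) : (0 < u < 1)%R ->
  (mu \x U) [set wt | (randomized_tail wt <= u)%R] = u%:E.
Proof.
move=> u01; have [a [/andP[pu upq] ltu]] := survival_crossing X u01.
pose p := fine (ccdf X a); pose q := fine (mu [set x | X x = a]).
have pE : ccdf X a = p%:E by rewrite fineK.
have qE : mu [set x | X x = a] = q%:E by rewrite fineK.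
have q0 : (0 <= q)%R by exact: fine_ge0.
rewrite upperE pE qE !lee_fin in pu upq.
pose c := U [set t | (p + t * q <= u)%R].
have c0 : 0 <= c by exact: measure_ge0.
rewrite /product_measure1.
rewrite (eq_integral (fun w => (\1_(X @^-1` `]a, +oo[%classic) w)%:E +
    c * (\1_[set x | X x = a] w)%:E)); last first.
  move=> w _ /=; rewrite [in LHS]xsectionE.
  rewrite -[LHS]/(U [set t | (fine (tail w) + t * fine (atom w) <= u)%R]).
  rewrite !indicE; case: (ltgtP (X w) a) => [wa|aw|wa].
  - rewrite memNset ?memNset/=; last 2 first.
    + by move=> wa'; rewrite wa' ltxx in wa.
    + by rewrite in_itv/= andbT ltNge (ltW wa).
    rewrite mule0 adde0; apply: unif01_affine_le0; first exact: fine_ge0.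
    by rewrite -lte_fin tailE fineK// ltu.
  - rewrite mem_set ?memNset/=; last 2 first.
    + by move=> wa'; rewrite wa' ltxx in aw.
    + by rewrite in_itv/= andbT.
    rewrite mule0 adde0; apply: unif01_affine_le1; first exact: fine_ge0.
    rewrite tailE /atom -fineD// -upperE (le_trans _ pu)// fine_le//.
    + by rewrite upperE fin_numD// ccdf_fin atom_fin.
    + apply: le_measure; rewrite ?inE//; first exact: preX.
      by move=> x /=; rewrite in_itv/= andbT; exact: lt_le_trans.
  - rewrite memNset ?mem_set//=; last by rewrite in_itv/= andbT wa ltxx.
    by rewrite add0e mule1 /c /p /q /atom tailE wa.
have mlevel : measurable_fun setT (fun w => (\1_[set x | X x = a] w)%:E : \bar R).
  exact/measurable_EFinP/measurable_indic.
rewrite ge0_integralD//; last 3 first.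
- exact/measurable_EFinP/measurable_indic/preX.
- by move=> w _; exact: mule_ge0.
- exact: measurable_funeM.
rewrite ge0_integralZl//.
rewrite !integral_indic//; last exact: preX.
rewrite !setIT [X in X + _]pE [X in _ * X]qE muleC unif01_affine_le; last first.
  by apply/andP.
by rewrite -EFinD addrC subrK.
Qed.

(** Rays determine a distribution on the line; the levels outside ]0, 1[ are
    reached by monotonicity. *)
Lemma randomized_tail_uniform (B : set R) : measurable B ->
  (mu \x U) (randomized_tail @^-1` B) = U B.
Proof.
pose m1 := restricted_law (finite_product mu U) measurableT measurable_randomized_tail.
have m1E D : (mu \x U) (randomized_tail @^-1` D) = m1 D.
  by rewrite /m1 /restricted_law /finite_product setTI.
rewrite m1E; move: B.
have m1T : m1 setT = 1.
  rewrite -m1E preimage_setT -setXTT.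
  have -> : (mu \x U) (setT `*` setT) = mu setT * U setT.
    exact: product_measure1E.
  by rewrite !probability_setT mule1.
have m1_mid u : (0 < u < 1)%R -> m1 `]-oo, u]%classic = u%:E.
  move=> u01; rewrite -m1E -(cdf_randomized_tail01 u01).
  have -> // : randomized_tail @^-1` `]-oo, u]%classic =
      [set wt | (randomized_tail wt <= u)%R].
    by apply/seteqP; split => x /=; rewrite in_itv.
have m1_mono u v : (u <= v)%R -> m1 `]-oo, u]%classic <= m1 `]-oo, v]%classic.
  by move=> uv; apply: le_measure; rewrite ?inE//; exact: subitvPr.
have m1_ray u : m1 `]-oo, u]%classic = U `]-oo, u]%classic.
  have [u0|u0] := leP u 0%R.
    have -> : U `]-oo, u]%classic = 0.
      apply/le_anti; rewrite measure_ge0 andbT.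
      have <- : U `]-oo, 0%R]%classic = 0 by rewrite unif01_ray// lexx ler01.
      by apply: le_measure; rewrite ?inE//; exact: subitvPr.
    apply/le_anti/andP; split => //; apply/lee_addgt0Pr => e e0; rewrite add0e.
    pose e' : R := Num.min e 2^-1%R.
    have e'01 : (0 < e' < 1)%R.
      by rewrite lt_min e0/= gt_min; apply/andP; split; [|apply/orP; right]; lra.
    have /le_trans -> // := m1_mono _ _ (le_trans u0 (ltW (proj1 (andP e'01)))).
    by rewrite m1_mid// lee_fin ge_min lexx.
  have [u1|u1] := ltP u 1%R; last first.
    have -> : U `]-oo, u]%classic = 1.
      apply: unif01_eq1; first exact: measurable_itv.
      by move=> x /=; rewrite !in_itv/= => /andP[_ x1]; exact: le_trans u1.
    apply/le_anti/andP; split.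
      by rewrite -m1T; apply: le_measure; rewrite ?inE.
    apply/lee_subgt0Pr => e e0.
    pose e' : R := Num.min e 2^-1%R.
    have e'01 : (0 < e' < 1)%R.
      by rewrite lt_min e0/= gt_min; apply/andP; split; [|apply/orP; right]; lra.
    have e'01' : (0 < 1 - e' < 1)%R by lra.
    apply: le_trans (m1_mono (1 - e')%R _ _); last by lra.
    by rewrite m1_mid// -EFinB lee_fin lerB// ge_min lexx.
  by rewrite m1_mid ?u0// unif01_ray// ltW//= ltW.
have mE : @measurable _ R = <<s @RGenOInfty.G R >> by exact: RGenOInfty.measurableE.
rewrite /m1; apply: (finite_measure_eq_pi mE) => //; rewrite -/m1.
- move=> _ _ [x ->] [y ->]; exists (Num.max x y).
  by apply/seteqP; split => z /=; rewrite !in_itv/= !andbT gt_max;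
    [case=> -> ->|move=> /andP[]].
- by transitivity (1%E : \bar R); [exact: m1T|exact/esym/probability_setT].
- by rewrite [ltLHS]m1T ltry.
- move=> _ [x ->]; rewrite -setCitvl.
  have UC : U (~` `]-oo, x]%classic) = 1 - U `]-oo, x]%classic.
    exact: probability_setC.
  have m1C : m1 (~` `]-oo, x]%classic) = m1 setT - m1 `]-oo, x]%classic.
    rewrite -setTD [LHS]measureD ?setTI//.
    by rewrite [ltLHS]m1T ltry.
  by rewrite [LHS]m1C [RHS]UC m1T m1_ray.
Qed.

End randomized_pit.

(** * Kernels and the joint laws they generate *)

Section kernel_pullback.
Context (R : realType) d (X : measurableType d) d' (Y : measurableType d')
  d'' (W : measurableType d'').
Variables (f : X -> Y) (K : R.-pker Y ~> W).

(** A kernel read on a larger space: taking for f a projection adds a variable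
    on which the kernel does not depend, such as the observed score or the
    random number. *)
Definition kernel_pullback (mf : measurable_fun setT f) :
  X -> {measure set W -> \bar R} := fun x => K (f x).

Variable mf : measurable_fun setT f.

Let measurable_kernel_pullback B : measurable B ->
  measurable_fun setT (kernel_pullback mf ^~ B).
Proof. by move=> mB; exact: (measurableT_comp (measurable_kernel K B mB) mf). Qed.

HB.instance Definition _ := isKernel.Build _ _ _ _ _ (kernel_pullback mf)
  measurable_kernel_pullback.

Let kernel_pullback_prob x : kernel_pullback mf x setT = 1%E.
Proof. exact: prob_kernel. Qed.

HB.instance Definition _ := Kernel_isProbability.Build _ _ _ _ _
  (kernel_pullback mf) kernel_pullback_prob.

End kernel_pullback.

Section semidirect.
Local Open Scope ereal_scope.
Context (R : realType) d (Y : measurableType d) d' (W : measurableType d').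
Variables (nu : {finite_measure set Y -> \bar R}) (K : R.-pker Y ~> W).

Lemma measurable_kernel_xsection (E : set (Y * W)) : measurable E ->
  measurable_fun setT (fun y => K y (xsection E y)).
Proof. by move=> mE; apply: measurable_fun_xsection_finite_kernel; rewrite inE. Qed.

Lemma kernel_le1 y B : measurable B -> K y B <= 1.
Proof. by move=> mB; rewrite -(prob_kernel (s := K) y) le_measure ?inE. Qed.

(** The joint law of (y, w) when y is drawn from [nu] and then w from [K y]. *)
Definition semidirect (E : set (Y * W)) := \int[nu]_y K y (xsection E y).

Let semidirect0 : semidirect set0 = 0.
Proof. by apply: integral0_eq => y _; rewrite xsection0 measure0. Qed.

Let semidirect_ge0 E : 0 <= semidirect E.
Proof. by apply: integral_ge0. Qed.

Let semidirect_sigma_additive : semi_sigma_additive semidirect.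
Proof.
move=> F mF tF mUF.
rewrite [X in _ --> X](_ : _ = \sum_(n <oo) semidirect (F n)).
  apply/cvg_closeP; split; last by rewrite closeE.
  by apply: is_cvg_nneseries => n _ _; exact: semidirect_ge0.
rewrite -integral_nneseries//; last by move=> n; exact: measurable_kernel_xsection.
apply: eq_integral => y _; apply/esym/cvg_lim => //=; rewrite xsection_bigcup.
apply: (measure_sigma_additive _ (trivIset_xsection tF)) => ?.
exact: measurable_xsection.
Qed.

HB.instance Definition _ := isMeasure.Build _ _ _ semidirect
  semidirect0 semidirect_ge0 semidirect_sigma_additive.

Let semidirect_fin : fin_num_fun semidirect.
Proof.
apply: lty_fin_num_fun; rewrite /= /semidirect.
rewrite (eq_integral (cst 1)); last first.
  by move=> y _; rewrite xsectionE preimage_setT prob_kernel.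
by rewrite integral_cst// mul1e ltey_eq fin_num_measure.
Qed.

HB.instance Definition _ := Measure_isFinite.Build _ _ _ semidirect semidirect_fin.

End semidirect.

(** * Randomized tails under a kernel *)

Lemma measurable_setb d (T : measurableType d) (f : T -> bool) :
  measurable_fun setT f -> measurable [set x | f x].
Proof. by move=> /(_ measurableT [set true] Logic.I); rewrite setTI. Qed.

Section kernel_fiber.
Context (R : realType) d (Y : measurableType d) d' (W : measurableType d').
Variables (K : R.-pker Y ~> W) (y : Y).

(** A head symbol to which the structure of probability can be attached. *)
Definition kernel_fiber : set W -> \bar R := K y.

HB.instance Definition _ := Measure.on kernel_fiber.

Let kernel_fiber_setT : kernel_fiber setT = 1%E. Proof. exact: prob_kernel. Qed.

HB.instance Definition _ :=
  Measure_isProbability.Build _ _ _ kernel_fiber kernel_fiber_setT.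

End kernel_fiber.

Section kernel_tail.
Context (R : realType) d (Y : measurableType d) d' (W : measurableType d').
Variables (K : R.-pker Y ~> W) (r : W -> R).
Hypothesis mr : measurable_fun setT r.

(** The p-value as a function of the summary y, the observed score a and the
    random number t. *)
Definition kernel_tail (yat : (Y * R) * R) : R :=
  fine (K yat.1.1 [set x | yat.1.2 < r x]) +
  yat.2 * fine (K yat.1.1 [set x | r x = yat.1.2]).

Lemma measurable_kernel_tail : measurable_fun setT kernel_tail.
Proof.
have msection (E : set ((Y * R) * W)%type) : measurable E ->
    measurable_fun setT (fun ya : Y * R => fine (K ya.1 [set x | E (ya, x)])).
  move=> mE; apply: measurableT_comp => //.
  rewrite (_ : (fun ya => _) = fun ya => K ya.1 (xsection E ya)); last first.
    by apply/funext => ya; rewrite xsectionE.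
  exact: (measurable_kernel_xsection (kernel_pullback K measurable_fst) mE).
have mgt : measurable_fun setT
    (fun ya : Y * R => fine (K ya.1 [set x | ya.2 < r x])).
  apply: (msection [set yax | yax.1.2 < r yax.2]).
  apply: measurable_setb; apply: measurable_fun_ltr.
    exact: measurableT_comp.
  exact: measurableT_comp.
have meq : measurable_fun setT
    (fun ya : Y * R => fine (K ya.1 [set x | r x = ya.2])).
  have -> : (fun ya : Y * R => fine (K ya.1 [set x | r x = ya.2])) =
      (fun ya : Y * R => fine (K ya.1 [set x | r x == ya.2])).
    apply/funext => ya; congr (fine (K ya.1 _)).
    by apply/seteqP; split => x /eqP.
  apply: (msection [set yax | r yax.2 == yax.1.2]).
  apply: measurable_setb; apply: measurable_fun_eqr.
    exact: measurableT_comp.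
  exact: measurableT_comp.
apply: measurable_funD; first exact: (measurableT_comp mgt).
by apply: measurable_funM => //; exact: (measurableT_comp meq).
Qed.

Local Open Scope ereal_scope.
Local Notation U := (unif01 R).

(** For a fixed y, [kernel_tail] is the randomized tail of r under K y; the
    random number is integrated last here, as in the product measure with its
    factors exchanged. *)
Lemma kernel_tail_uniform y (B : set R) : measurable B ->
  \int[U]_t K y [set x | B (kernel_tail ((y, r x), t))] = U B.
Proof.
move=> mB.
pose mu : probability W R := kernel_fiber K y.
pose X : {RV mu >-> R} := HB.pack r (isMeasurableFun.Build _ _ _ _ r mr).
have mE : measurable (randomized_tail X @^-1` B).
  rewrite -[X in measurable X]setTI; exact: measurable_randomized_tail.
rewrite -(randomized_tail_uniform X mB).
transitivity ((mu \x^ U) (randomized_tail X @^-1` B)).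
  by apply: eq_integral => t _ /=; rewrite ysectionE.
by apply/esym/product_measure_unique => // C D mC mD; exact: product_measure2E.
Qed.

Variables (nu : {finite_measure set Y -> \bar R}).
Variables (m : {finite_measure set ((Y * R) * W)%type -> \bar R}).
Hypothesis mE : forall C D B, measurable C -> measurable D -> measurable B ->
  m ((C `*` D) `*` B) = U D * \int[nu]_(y in C) K y B.

(** Under m, x has conditional law K y given y, and t is uniform and independent
    of (y, x): this is the hypothesis on rectangles, and it makes m a semidirect
    product. The p-value is then uniform given y for each y separately, so that
    nu is arbitrary; taking for nu a law on an event is what conditions on the
    observations to come. *)
Lemma conditionally_uniform (B : set R) (C : set Y) :
  measurable B -> measurable C ->
  m [set ytx | B (kernel_tail ((ytx.1.1, r ytx.2), ytx.1.2)) /\ C ytx.1.1] =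
  U B * nu C.
Proof.
move=> mB mC; set E := [set ytx | _].
pose K' := kernel_pullback K (@measurable_fst _ _ Y R).
have mE' : measurable E.
  have mg : measurable_fun setT (fun ytx : (Y * R) * W =>
      kernel_tail ((ytx.1.1, r ytx.2), ytx.1.2)).
    apply: (measurableT_comp measurable_kernel_tail).
    apply: measurable_fun_pair; last exact: measurableT_comp.
    by apply: measurable_fun_pair; exact: measurableT_comp.
  apply: measurableI; first by rewrite -[X in measurable X]setTI; exact: mg.
  have mf : measurable_fun setT (fun ytx : (Y * R) * W => ytx.1.1).
    exact: measurableT_comp.
  by rewrite -[X in measurable X]setTI; exact: mf.
have tonelli (D : set ((Y * R) * W)%type) : measurable D ->
    semidirect (finite_product nu U) K' D =
    \int[nu]_y \int[U]_t K y [set x | D ((y, t), x)].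
  move=> mD; rewrite /semidirect /finite_product.
  rewrite fubini_tonelli1; [|exact: (measurable_kernel_xsection K' mD)|by move=> x].
  apply: eq_integral => y _; apply: eq_integral => t _.
  by rewrite xsectionE.
have -> : m E = semidirect (finite_product nu U) K' E.
  apply: finite_measure_eq_rect3 => // C' D' B' mC' mD' mB'.
  rewrite mE// [RHS]tonelli; last by apply: measurableX => //; exact: measurableX.
  have mKC : measurable_fun setT ((fun y => K y B') \_ C').
    by apply/(measurable_restrictT _ mC')/measurable_funTS; exact: measurable_kernel.
  have mD'' : measurable_fun setT (fun t => (\1_D' t)%:E : \bar R).
    exact/measurable_EFinP/measurable_indic.
  have KC0 y : 0 <= ((fun y => K y B') \_ C') y by exact: erestrict_ge0.
  rewrite [X in _ * X]integral_mkcond muleC -ge0_integralZr//.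
  apply: eq_integral => y _; rewrite patchE; case: ifPn => yC'.
    rewrite muleC -[D' in U D']setIT -integral_indic// -ge0_integralZr//.
    apply: eq_integral => t _; rewrite indicE; have [tD'|tD'] := boolP (t \in D').
      rewrite mul1e; congr (K y _); apply/seteqP; split=> x /=; last by case.
      by rewrite !inE in yC' tD'.
    rewrite mul0e -[LHS](measure0 (K y)); congr (K y _).
    by apply/seteqP; split => x //= [[_ /mem_set]]; rewrite (negbTE tD').
  rewrite mul0e; apply/esym/integral0_eq => t _; rewrite -[RHS](measure0 (K y)).
  congr (K y _); apply/seteqP; split => x //= [[/mem_set]].
  by rewrite (negbTE yC').
rewrite tonelli// -[C in nu C]setIT -integral_indic//.
rewrite -ge0_integralZl//; last exact/measurable_EFinP/measurable_indic.
apply: eq_integral => y _; rewrite indicE; have [yC|yC] := boolP (y \in C).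
  rewrite mule1 -(kernel_tail_uniform y mB); apply: eq_integral => t _.
  congr (K y _); apply/seteqP; split => x /=; first by case.
  by move=> ?; split => //; exact: set_mem.
rewrite mule0; apply: integral0_eq => t _; rewrite -[RHS](measure0 (K y)).
congr (K y _); apply/seteqP; split => x //= [_ /mem_set].
by rewrite (negbTE yC).
Qed.

End kernel_tail.

(** * Conditional independence in terms of kernels *)

Section density_product.
Local Open Scope ereal_scope.
Context (R : realType) d (Y : measurableType d).
Variables (la : probability Y R) (nu : {finite_measure set Y -> \bar R}).

(** As densities are unique almost everywhere, g1 can be replaced by k and g2 by
    the Radon-Nikodym derivative of nu, which is nonnegative everywhere; then
    integrating k times this derivative against la is integrating k against nu.
    With conditional probabilities for g1, g2 and g12, the product formula for
    g12 is conditional independence. *)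
Lemma integral_density_product (k g1 g2 g12 : Y -> R) :
  (forall y, (0 <= k y)%R) -> measurable_fun setT k ->
  la.-integrable setT (EFin \o k) -> la.-integrable setT (EFin \o g1) ->
  la.-integrable setT (EFin \o g2) -> measurable_fun setT g12 ->
  (forall C, measurable C ->
    \int[la]_(y in C) (g1 y)%:E = \int[la]_(y in C) (k y)%:E) ->
  (forall C, measurable C -> \int[la]_(y in C) (g2 y)%:E = nu C) ->
  {ae la, forall y, g12 y = (g1 y * g2 y)%R} ->
  forall C, measurable C ->
  \int[la]_(y in C) (g12 y)%:E = \int[nu]_(y in C) (k y)%:E.
Proof.
move=> k0 mk ik i1 i2 m12 g1k g2nu g12E C mC.
have nula : nu `<< la.
  apply/null_content_dominatesP => A mA A0; rewrite -g2nu//.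
  apply: null_set_integral => //; apply: measurable_funTS; exact: measurable_int i2.
pose f := Radon_Nikodym_SigmaFinite.f nu la.
have intf : la.-integrable setT f by exact: Radon_Nikodym_SigmaFinite.f_integrable.
have k1 : ae_eq la setT (EFin \o g1) (EFin \o k).
  by apply: integral_ae_eq => //; [exact: measurable_int ik|move=> A _; exact: g1k].
have f2 : ae_eq la setT (EFin \o g2) f.
  apply: integral_ae_eq => //; first exact: measurable_int intf.
  by move=> A _ mA; rewrite g2nu// (Radon_Nikodym_SigmaFinite.f_integral nula).
rewrite -(Radon_Nikodym_SigmaFinite.change_of_variables nula)//; last first.
  exact/measurable_EFinP/measurable_funTS.
apply: ae_eq_integral => //.
- exact/measurable_EFinP/measurable_funTS.
- apply: measurable_funTS; apply: emeasurable_funM.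
    exact/measurable_EFinP.
  exact: measurable_int intf.
- move: g12E k1 f2; apply: filterS3 => y /= -> /(_ Logic.I) gk /(_ Logic.I) gf _.
  by rewrite EFinM [X in X * _ = _]gk [X in _ * X = _]gf.
Qed.

End density_product.

Section conditional_independence.
Local Open Scope ereal_scope.
Context (R : realType) d (X : measurableType d) (P : probability X R).
Context d' (Y : measurableType d') d1 (W : measurableType d1) d2
  (W2 : measurableType d2).
Variables (T : X -> Y) (V : X -> W) (V2 : X -> W2).
Hypothesis mT : measurable_fun setT T.

Let TT : {mfun X >-> Y} := HB.pack T (isMeasurableFun.Build _ _ _ _ T mT).
Let la := distribution P TT.

Let cond_prob_integrable E g : cond_prob P T E g -> la.-integrable setT (EFin \o g).
Proof.
move=> [mg ig _]; apply: integrable_pushforward => //.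
exact/measurable_EFinP.
Qed.

Let cond_prob_integral E g C : cond_prob P T E g -> measurable C ->
  \int[la]_(y in C) (g y)%:E = P (E `&` T @^-1` C).
Proof.
move=> [mg ig gE] mC; rewrite -gE//; apply: integral_pushforward => //.
  exact/measurable_EFinP.
apply: integrableS ig => //; rewrite -[Z in measurable Z]setTI; exact: mT.
Qed.

Variable K : R.-pker Y ~> W.

(** Given T, an event of V2 does not change the conditional law K of V: it only
    replaces the law of T by its law on that event, whose density is the
    conditional probability of the event given T. *)
Lemma cond_independent_integral (B : set W) (E : set W2) (C : set Y)
    (mE : measurable (V2 @^-1` E)) :
  regular_cond_distr P T V K -> cond_independent P T V V2 ->
  measurable B -> measurable E -> measurable C ->
  P (V2 @^-1` E `&` T @^-1` C `&` V @^-1` B) =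
  \int[restricted_law P mE mT]_(y in C) K y B.
Proof.
move=> KV VV2 mB mE' mC.
have [g1 [g2 [g12 [c1 c2 c12 g12E]]]] := VV2 _ _ mB mE'.
have ck := KV _ mB.
have kE y : (fine (K y B))%:E = K y B.
  by rewrite fineK// ge0_fin_numE// (le_lt_trans (kernel_le1 _ _ _))// ltry.
transitivity (\int[restricted_law P mE mT]_(y in C) (fine (K y B))%:E); last first.
  by apply: eq_integral => y _; rewrite kE.
rewrite setIC setIA -(cond_prob_integral c12 mC).
apply: (@integral_density_product _ _ _ la _ (fun y => fine (K y B)) g1 g2) => //.
- by case: ck.
- exact: cond_prob_integrable ck.
- exact: cond_prob_integrable c1.
- exact: cond_prob_integrable c2.
- by case: c12.
- by move=> D mD; rewrite (cond_prob_integral c1)// (cond_prob_integral ck).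
- by move=> D mD; rewrite (cond_prob_integral c2).
have [[[m1 _ _] [m2 _ _]] [m12 _ _]] := (c1, c2, c12).
pose N := [set y | g12 y != (g1 y * g2 y)%R].
have mN : measurable N.
  have -> : N = ~` [set y | g12 y == (g1 y * g2 y)%R].
    by apply/seteqP; split => y /negP.
  apply: measurableC; apply: measurable_setb; apply: measurable_fun_eqr => //.
  exact: measurable_funM.
exists N; split => //.
- have [N' [mN' N'0 sub]] := g12E.
  apply/eqP; rewrite eq_le measure_ge0 andbT -N'0.
  change (P (T @^-1` N) <= P N'); apply: le_measure; rewrite ?inE//.
    rewrite -[Z in measurable Z]setTI; exact: mT.
  by move=> x /= /eqP Nx; apply: sub.
- by move=> y /= /eqP.
Qed.

End conditional_independence.

(** * Sequence spaces and independent sequences *)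

Section sequence_space.
Context d (Z : measurableType d).

Lemma measurable_coordinate i : measurable_fun setT (fun z : seqspace Z => z i).
Proof.
by move=> _ B mB; rewrite setTI; apply: sub_sigma_algebra; exists i, B.
Qed.

Lemma measurable_to_seqspace d' (X : measurableType d') (f : X -> seqspace Z) :
  (forall i, measurable_fun setT (fun x => f x i)) -> measurable_fun setT f.
Proof.
move=> mf; apply: (@measurability _ _ X (seqspace Z) _ _ (@cylinders _ Z)) => //.
by move=> _ [_ [i [B [mB ->]]] <-]; exact: mf.
Qed.

Lemma measurable_tail_seq n : measurable_fun setT (@tail_seq _ Z n).
Proof. by apply: measurable_to_seqspace => i; exact: measurable_coordinate. Qed.

Lemma measurable_init_seg n : measurable_fun setT (@init_seg _ Z n).
Proof.
apply/measurable_fun_tnthP => i.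
rewrite (_ : _ \o _ = fun z : seqspace Z => z (val i)).
  exact: measurable_coordinate.
by apply/funext => z; rewrite /= tnth_mktuple.
Qed.

Lemma measurable_butlast n : measurable_fun setT (@butlast Z n).
Proof.
apply/measurable_fun_tnthP => i.
rewrite (_ : _ \o _ = fun t : n.+1.-tuple Z => tnth t (widen_ord (leqnSn n) i)).
  exact: measurable_tnth.
by apply/funext => t; rewrite /= tnth_mktuple.
Qed.

Lemma init_segS n (z : seqspace Z) :
  init_seg n.+1 z = [tuple of rcons (init_seg n z) (z n)] :> n.+1.-tuple Z.
Proof.
apply: eq_from_tnth => i; rewrite tnth_mktuple (tnth_nth (z n)).
rewrite -[tval _]/(rcons (init_seg n z) (z n)) nth_rcons size_tuple.
case: ltngtP => [ni|ni|ni]; last exact: (congr1 z ni).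
  transitivity (tnth (init_seg n z) (Ordinal ni)); last exact: tnth_nth.
  by rewrite tnth_mktuple.
by have := ltn_ord i; rewrite ltnS leqNgt ni.
Qed.

Lemma butlast_init_seg n (z : seqspace Z) :
  butlast (init_seg n.+1 z) = init_seg n z.
Proof. by apply: eq_from_tnth => i; rewrite !tnth_mktuple. Qed.

Lemma last_init_seg n (z : seqspace Z) : tnth (init_seg n.+1 z) ord_max = z n.
Proof. by rewrite tnth_mktuple. Qed.

Lemma tail_seq0 n (z : seqspace Z) : tail_seq n z 0%N = z n.
Proof. by rewrite /tail_seq addn0. Qed.

Lemma tail_seqS n (z : seqspace Z) : tail_seq 1 (tail_seq n z) = tail_seq n.+1 z.
Proof. by apply/funext => i; rewrite /tail_seq addnA addn1. Qed.

(** A pi-system generating the product sigma-algebra, which the cylinders are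
    not since they constrain a single coordinate. *)
Definition boxes : set (set (seqspace Z)) :=
  [set E | exists N (B : nat -> set Z), (forall i, measurable (B i)) /\
    E = [set z | forall i, (i < N)%N -> B i (z i)]].

Lemma setI_closed_boxes : setI_closed boxes.
Proof.
move=> _ _ [N [B [mB ->]]] [N' [B' [mB' ->]]].
exists (maxn N N'),
  (fun i => [set x | ((i < N)%N -> B i x) /\ ((i < N')%N -> B' i x)]).
split=> [i|].
  rewrite (_ : [set x | _] = (if (i < N)%N then B i else setT) `&`
    (if (i < N')%N then B' i else setT)).
    by apply: measurableI; case: ifP.
  by apply/seteqP; split => x /=; case: (i < N)%N; case: (i < N')%N => -[h1 h2];
    split => //; auto.
apply/seteqP; split => z /=.
  by move=> [zB zB'] i _; split=> iN; [exact: zB|exact: zB'].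
move=> zBB'; split => i iN.
  by have [|+ _] := zBB' i; [rewrite leq_max iN|exact].
by have [|_] := zBB' i; [rewrite leq_max iN orbT|exact].
Qed.

Lemma measurable_boxes : @measurable _ (seqspace Z) = <<s boxes >>.
Proof.
apply/seteqP; split; apply: smallest_sub; first exact: smallest_sigma_algebra.
- move=> _ [i [B [mB ->]]]; apply: sub_sigma_algebra.
  exists i.+1, (fun j => if j == i then B else setT); split=> [j|].
    by case: ifP.
  apply/seteqP; split => z /=.
    by move=> Bz j _; case: eqP => [->|].
  by move=> /(_ i (ltnSn i)); rewrite eqxx.
- exact: sigma_algebra_measurable.
- move=> _ [N [B [mB ->]]].
  rewrite (_ : [set z | _] =
      \bigcap_(i in `I_N) ((fun z : seqspace Z => z i) @^-1` B i)).
    apply: bigcap_measurableType => i _; rewrite -[X in measurable X]setTI.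
    exact: measurable_coordinate.
  by apply/seteqP; split => z.
Qed.

End sequence_space.

Section prefix_independence.
Context (R : realType) d (X : measurableType d) (mu : probability X R).
Context d' (W : measurableType d') (V : nat -> X -> W).
Local Open Scope ereal_scope.

Lemma mutually_independent_prefix : mutually_independent mu V ->
  forall N (B : nat -> set W), (forall i, measurable (B i)) ->
  mu [set x | forall i, (i < N)%N -> B i (V i x)] =
  \prod_(i < N) mu (V i @^-1` B i).
Proof.
move=> Vi N B mB; pose J := [fset i in iota 0 N]%fset.
have JE i : (i \in J) = (i < N)%N by rewrite !inE /= mem_iota.
rewrite -(big_mkord predT (fun i => mu (V i @^-1` B i))) /index_iota subn0.
rewrite (perm_big (enum_fset J)) /=; last first.
  apply: uniq_perm; [exact: iota_uniq|exact: fset_uniq|move=> i].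
  by rewrite JE mem_iota.
rewrite -Vi//; congr (mu _); apply/seteqP; split => x /= xB i /=.
  by rewrite JE; exact: xB.
by rewrite -JE; exact: xB.
Qed.

(** Initial segments suffice: an index below N outside J can be given the full
    set, which has probability 1. *)
Lemma prefix_mutually_independent :
  (forall N (B : nat -> set W), (forall i, measurable (B i)) ->
    mu [set x | forall i, (i < N)%N -> B i (V i x)] =
    \prod_(i < N) mu (V i @^-1` B i)) ->
  mutually_independent mu V.
Proof.
move=> Vprefix J B mB.
have [N JN] : exists N, forall i, i \in J -> (i < N)%N.
  by exists (\max_(i <- J) i).+1 => i iJ; rewrite ltnS; exact: leq_bigmax_seq.
pose B' i := if i \in J then B i else setT.
have mB' i : measurable (B' i) by rewrite /B'; case: ifP.
have -> : \bigcap_(i in [set` J]) (V i @^-1` B i) =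
    [set x | forall i, (i < N)%N -> B' i (V i x)].
  apply/seteqP; split => x /= xB i.
    by move=> _; rewrite /B'; case: ifP => // /xB.
  by move=> iJ; have := xB i (JN i iJ); rewrite /B' iJ.
rewrite Vprefix// -(big_mkord predT (fun i => mu (V i @^-1` B' i))) /index_iota subn0.
rewrite (bigID (mem J)) /= [X in _ * X]big1 ?mule1; last first.
  by move=> i /negbTE iJ; rewrite /B' iJ preimage_setT probability_setT.
rewrite -big_filter (perm_big (enum_fset J)); last first.
  apply: uniq_perm; [exact/filter_uniq/iota_uniq|exact: fset_uniq|move=> i].
  by rewrite mem_filter mem_iota /=; case: (boolP (i \in J)) => //= /JN.
by rewrite big_seq [RHS]big_seq; apply: eq_bigr => i iJ; rewrite /B' iJ.
Qed.

End prefix_independence.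

(** * Uniform random numbers independent of the observations *)

Section uniform_sequence.
Context (R : realType) d (Omega : measurableType d) (Pr : probability Omega R).
Variable tau : Omega -> seqspace R.
Hypothesis tau_law : Uinfty_distributed Pr tau.
Local Open Scope ereal_scope.
Local Notation U := (unif01 R).

Lemma Uinfty_measurable : measurable_fun setT tau.
Proof. by apply: measurable_to_seqspace => i; have [] := tau_law.1 i. Qed.

Lemma Uinfty_coordinate n B : measurable B -> Pr [set w | B (tau w n)] = U B.
Proof. by move=> mB; have [_ /(_ B mB)] := tau_law.1 n. Qed.

(** On boxes this is mutual independence, and boxes form a pi-system. *)
Lemma Uinfty_coordinate_tail n B G : measurable B -> measurable G ->
  Pr ([set w | B (tau w n)] `&` (@tail_seq _ R n.+1 \o tau) @^-1` G) =
  U B * Pr ((@tail_seq _ R n.+1 \o tau) @^-1` G).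
Proof.
move=> mB mG.
have box N (D : nat -> set R) B' : (forall i, measurable (D i)) -> measurable B' ->
    Pr ([set w | B' (tau w n)] `&` (@tail_seq _ R n.+1 \o tau) @^-1`
      [set z | forall i, (i < N)%N -> D i (z i)]) =
    U B' * \prod_(i < N) U (D i).
  move=> mD mB'.
  (* Coordinate n + 1 + i of the sequence is coordinate i of its tail. *)
  pose E i := if (i < n)%N then setT else if i == n then B' else D (i - n.+1)%N.
  have mE i : measurable (E i) by rewrite /E; case: ifP => // _; case: ifP.
  transitivity (Pr [set w | forall i, (i < n.+1 + N)%N -> E i (tau w i)]).
    congr (Pr _); apply/seteqP; split => w /=.
      move=> [Bw Dw] i iN; rewrite /E; case: ltnP => // ni.
      case: eqP => [->//|/eqP ni'].
      have lt_ni : (n < i)%N by rewrite ltn_neqAle eq_sym ni'.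
      have := Dw (i - n.+1)%N; rewrite /tail_seq subnKC//; apply.
      by rewrite ltn_subLR.
    move=> Ew; split.
      by have := Ew n; rewrite /E ltnn eqxx; apply; rewrite ltnS leq_addr.
    move=> i iN; rewrite /tail_seq; have := Ew (n.+1 + i)%N.
    rewrite /E ltn_add2l iN.
    rewrite addSn ltnNge leqW ?leq_addr//= gtn_eqF ?ltnS ?leq_addr//.
    by rewrite -addSn addKn; apply.
  rewrite (mutually_independent_prefix tau_law.2)// big_split_ord/= big_ord_recr/=.
  rewrite big1 ?mul1e; last first.
    by move=> i _; rewrite /E ltn_ord preimage_setT probability_setT.
  congr (_ * _).
    by rewrite /E ltnn eqxx; exact: Uinfty_coordinate.
  apply: eq_bigr => i _; rewrite /E addSn ltnNge leqW ?leq_addr//=.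
  rewrite gtn_eqF ?ltnS ?leq_addr// -addSn addKn.
  exact: Uinfty_coordinate.
have Ub0 : (0 <= fine (U B))%R by exact: fine_ge0.
pose c := NngNum Ub0.
have cE : c%:num%:E = U B by rewrite /= fineK// fin_num_measure.
have mtail : measurable_fun setT (@tail_seq _ R n.+1 \o tau).
  exact: (measurableT_comp (@measurable_tail_seq _ _ _) Uinfty_measurable).
have mA : measurable [set w | B (tau w n)].
  by have [+ _] := tau_law.1 n => /(_ measurableT B mB); rewrite setTI.
rewrite -[X in _ = _ * Pr X]setTI -cE.
apply: (scaled_law_pi mtail mA measurableT (measurable_boxes _)
  (@setI_closed_boxes _ _)) => //.
  rewrite cE [X in _ * X](@probability_setT _ _ _ Pr) mule1.
  exact: Uinfty_coordinate.
move=> _ [N [D [mD ->]]]; rewrite [LHS]box// cE; congr (_ * _).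
have := box N D setT mD measurableT.
by rewrite !setTI (@probability_setT _ _ _ U) mul1e => <-.
Qed.

Context d' (Z : measurableType d') (P : probability (seqspace Z) R).
Variable zeta : Omega -> seqspace Z.
Hypothesis zeta_law : has_law Pr zeta P.
Hypothesis zeta_tau : independent2 Pr zeta tau.

Lemma zeta_coordinate n C B : measurable C -> measurable B ->
  Pr (zeta @^-1` C `&` [set w | B (tau w n)]) = P C * U B.
Proof.
move=> mC mB; rewrite -(Uinfty_coordinate n mB) -(zeta_law.2 C mC).
rewrite (_ : [set w | B (tau w n)] = tau @^-1` [set t | B (t n)])//.
apply: zeta_tau => //; rewrite -[X in measurable X]setTI.
exact: measurable_coordinate.
Qed.

(** On rectangles, the observations are first separated from the random numbers,
    and then tau_n from the later ones. *)
Lemma present_future_independent n (Q : set (seqspace Z * R)%type) G :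
  measurable Q -> measurable G ->
  Pr ((@tail_seq _ R n.+1 \o tau) @^-1` G `&` [set w | Q (zeta w, tau w n)]) =
  Pr ((@tail_seq _ R n.+1 \o tau) @^-1` G) * Pr [set w | Q (zeta w, tau w n)].
Proof.
move=> mQ mG; set A := _ @^-1` G.
have mA : measurable A.
  have mtail : measurable_fun setT (@tail_seq _ R n.+1 \o tau).
    exact: (measurableT_comp (@measurable_tail_seq _ _ _) Uinfty_measurable).
  by rewrite -[X in measurable X]setTI; exact: mtail.
have PA0 : (0 <= fine (Pr A))%R by exact: fine_ge0.
pose c := NngNum PA0.
have cE : c%:num%:E = Pr A by rewrite /= fineK// fin_num_measure.
rewrite -[X in _ = _ * Pr X]setTI -cE.
have mV : measurable_fun setT (fun w => (zeta w, tau w n)).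
  apply: measurable_fun_pair; first by case: zeta_law.
  by have [] := tau_law.1 n.
apply: (scaled_law_pi mV mA measurableT (measurable_prod_measurableType _ _)) => //.
- move=> _ _ [C mC [B mB <-]] [C' mC' [B' mB' <-]].
  by exists (C `&` C'); [exact: measurableI|exists (B `&` B');
    [exact: measurableI|rewrite setXI]].
- by rewrite cE [X in _ * X](@probability_setT _ _ _ Pr) mule1.
- move=> _ [C mC [B mB <-]]; rewrite setTI cE.
  have -> : (fun w => (zeta w, tau w n)) @^-1` (C `*` B) =
    zeta @^-1` C `&` [set w | B (tau w n)] by [].
  rewrite [X in _ = _ * X]zeta_coordinate//.
  have -> : A `&` (zeta @^-1` C `&` [set w | B (tau w n)]) = zeta @^-1` C `&`
      tau @^-1` [set t | B (t n) /\ G (tail_seq n.+1 t)].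
    by apply/seteqP; split => w /=; tauto.
  rewrite [LHS]zeta_tau//; last first.
    apply: measurableI; rewrite -[X in measurable X]setTI.
      exact: measurable_coordinate.
    exact: measurable_tail_seq.
  have := Uinfty_coordinate_tail n mB mG.
  rewrite -/A (_ : _ `&` A = tau @^-1` [set t | B (t n) /\ G (tail_seq n.+1 t)])//.
  by move=> ->; rewrite (zeta_law.2 C mC) muleA muleC.
Qed.

End uniform_sequence.

(** * The p-values *)

Section online_compression.
Context (R : realType) (d : measure_display) (Z : measurableType d)
  (dS : nat -> measure_display) (Sigma : forall n, measurableType (dS n))
  (S : forall n, n.-tuple Z -> Sigma n) (S_stat : statistics S)
  (Pm : set (probability (seqspace Z) R)) (S_ATTS : ATTS Pm S)
  (K : forall n, R.-pker (Sigma n) ~> (n.-tuple Z))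
  (K_cond : common_cond_distr Pm S K)
  (A : forall n, Sigma n * Z -> R) (A_ncm : nonconformity_measure A)
  (P : probability (seqspace Z) R) (P_Pm : Pm P)
  (d' : measure_display) (Omega : measurableType d') (Pr : probability Omega R)
  (zeta : Omega -> seqspace Z) (zeta_law : has_law Pr zeta P)
  (tau : Omega -> seqspace R) (tau_law : Uinfty_distributed Pr tau)
  (zeta_tau : independent2 Pr zeta tau).
Local Open Scope ereal_scope.
Local Notation U := (unif01 R).

Let score n := nonconformity_score S A (n := n).
Let stat n (z : seqspace Z) := S (init_seg n z).
Let pval n (z : seqspace Z) (t : R) := pvalue S A K (init_seg n.+1 z) t.

Let pvalE n z t :
  pval n z t =
  kernel_tail (K n.+1) (@score n) ((stat n.+1 z, score (init_seg n.+1 z)), t).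
Proof. by []. Qed.

Let measurable_score n : measurable_fun setT (@score n).
Proof.
have mS : measurable_fun setT (fun x : n.+1.-tuple Z => S (butlast x)).
  exact: (measurableT_comp (S_stat n).1 (@measurable_butlast _ _ _)).
exact: (measurableT_comp (@A_ncm n)
  (measurable_fun_pair mS (@measurable_tnth _ Z n.+1 ord_max))).
Qed.

Let measurable_stat n : measurable_fun setT (stat n).
Proof. by apply: measurableT_comp (@measurable_init_seg _ _ _); case: (S_stat n). Qed.

Let measurable_pval n : measurable_fun setT (fun zt : seqspace Z * R => pval n zt.1 zt.2).
Proof.
have m1 : measurable_fun setT (fun zt : seqspace Z * R => stat n.+1 zt.1).
  exact: (measurableT_comp (@measurable_stat n.+1)).
have m2 : measurable_fun setT
    (fun zt : seqspace Z * R => score (init_seg n.+1 zt.1)).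
  apply: (measurableT_comp (@measurable_score n)).
  exact: (measurableT_comp (@measurable_init_seg _ _ _)).
exact: (measurableT_comp (measurable_kernel_tail (K n.+1) (@measurable_score n))
  (measurable_fun_pair (measurable_fun_pair m1 m2) measurable_snd)).
Qed.

Let measurable_pval_Omega n : measurable_fun setT (fun w => pval n (zeta w) (tau w n)).
Proof.
have [mt _] := tau_law.1 n.
exact: (measurableT_comp (@measurable_pval n) (measurable_fun_pair zeta_law.1 mt)).
Qed.

(** The event E of the observations to come enters only through the law of the
    summary on it, since the summary and the past keep their conditional law. *)
Lemma present_uniform n (B : set R) (C : set (Sigma n.+1)) (E : set (seqspace Z)) :
  measurable B -> measurable C -> measurable E ->
  Pr [set w | [/\ B (pval n (zeta w) (tau w n)), C (stat n.+1 (zeta w))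
                & E (tail_seq n.+1 (zeta w))]] =
  U B * P [set z | C (stat n.+1 z) /\ E (tail_seq n.+1 z)].
Proof.
move=> mB mC mE.
have mtE : measurable (@tail_seq _ Z n.+1 @^-1` E).
  by rewrite -[X in measurable X]setTI; exact: measurable_tail_seq.
have mztE : measurable (zeta @^-1` (@tail_seq _ Z n.+1 @^-1` E)).
  by rewrite -[X in measurable X]setTI; apply: zeta_law.1.
pose V w := ((stat n.+1 (zeta w), tau w n), init_seg n.+1 (zeta w)).
have mV : measurable_fun setT V.
  apply: measurable_fun_pair; last first.
    by apply: (measurableT_comp (@measurable_init_seg _ _ _)); case: zeta_law.
  apply: measurable_fun_pair; last by have [] := tau_law.1 n.
  by apply: (measurableT_comp (@measurable_stat n.+1)); case: zeta_law.
pose m := restricted_law Pr mztE mV.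
pose nu := restricted_law P mtE (@measurable_stat n.+1).
have -> : Pr [set w | [/\ B (pval n (zeta w) (tau w n)), C (stat n.+1 (zeta w))
    & E (tail_seq n.+1 (zeta w))]] =
    m [set ytx | B (kernel_tail (K n.+1) (@score n) ((ytx.1.1, score ytx.2), ytx.1.2))
      /\ C ytx.1.1].
  congr (Pr _); apply/seteqP.
  by split => w /=; [case=> Bw Cw Ew|case=> Ew [Bw Cw]].
have -> : P [set z | C (stat n.+1 z) /\ E (tail_seq n.+1 z)] = nu C.
  congr (P _); apply/seteqP.
  by split => z /= -[].
apply: (conditionally_uniform (@measurable_score n)) => // C' D B' mC' mD mB'.
have -> : \int[nu]_(y in C') K n.+1 y B' =
    P (@tail_seq _ Z n.+1 @^-1` E `&` stat n.+1 @^-1` C' `&` @init_seg _ Z n.+1 @^-1` B').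
  apply/esym/cond_independent_integral => //.
  - exact: K_cond.
  - by apply: (S_ATTS.2 n.+1 _).2.
rewrite muleC -(zeta_coordinate tau_law zeta_law zeta_tau n)//; last first.
  apply: measurableI.
    apply: measurableI => //; rewrite -[X in measurable X]setTI.
    exact: measurable_stat.
  by rewrite -[X in measurable X]setTI; exact: measurable_init_seg.
congr (Pr _); apply/seteqP; split => w /=; tauto.
Qed.

(** All that the p-values after time n depend on. *)
Let state n w : (Sigma n * seqspace Z) * seqspace R :=
  ((stat n (zeta w), tail_seq n (zeta w)), tail_seq n (tau w)).

Let measurable_state n : measurable_fun setT (state n).
Proof.
have mz : measurable_fun setT zeta by case: zeta_law.
have mt := Uinfty_measurable tau_law.
apply: measurable_fun_pair; last exact: (measurableT_comp (@measurable_tail_seq _ _ _)).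
apply: measurable_fun_pair; first exact: (measurableT_comp (@measurable_stat n)).
exact: (measurableT_comp (@measurable_tail_seq _ _ _)).
Qed.

(** Both sides are finite measures in D, so D can be taken a rectangle; the later
    random numbers then factor out of both, which leaves [present_uniform]. *)
Lemma pval_state_independent n (B : set R) D : measurable B -> measurable D ->
  Pr ([set w | B (pval n (zeta w) (tau w n))] `&` state n.+1 @^-1` D) =
  U B * Pr (state n.+1 @^-1` D).
Proof.
move=> mB; move: D.
have mpB : measurable [set w | B (pval n (zeta w) (tau w n))].
  by rewrite -[X in measurable X]setTI; exact: measurable_pval_Omega.
have UB0 : (0 <= fine (U B))%R by exact: fine_ge0.
pose c := NngNum UB0.
have cE : c%:num%:E = U B by rewrite /= fineK// fin_num_measure.
pose m1 := restricted_law Pr mpB (@measurable_state n.+1).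
pose m2 := mscale c (restricted_law Pr measurableT (@measurable_state n.+1)).
suff H D : measurable D -> m1 D = m2 D.
  by move=> D /H; rewrite /m1 /m2 /mscale /restricted_law /= setTI -cE.
apply: finite_measure_eq_rect3 => C E G mC mE mG.
have mCE : measurable [set z | C (stat n.+1 z) /\ E (tail_seq n.+1 z)].
  by apply: measurableI; rewrite -[X in measurable X]setTI;
    [exact: measurable_stat|exact: measurable_tail_seq].
have mfst (Q : set (seqspace Z)) : measurable Q ->
    measurable [set zt : seqspace Z * R | Q zt.1].
  by move=> mD; rewrite -[X in measurable X]setTI; exact: measurable_fst.
have mpv : measurable [set zt : seqspace Z * R | B (pval n zt.1 zt.2)].
  by rewrite -[X in measurable X]setTI; exact: measurable_pval.
have law_CE : Pr [set w | C (stat n.+1 (zeta w)) /\ E (tail_seq n.+1 (zeta w))] =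
    P [set z | C (stat n.+1 z) /\ E (tail_seq n.+1 z)].
  by rewrite -(zeta_law.2 _ mCE).
have := present_future_independent tau_law zeta_law zeta_tau n (mfst _ mCE) mG.
rewrite /= law_CE => future.
have := present_future_independent tau_law zeta_law zeta_tau n
  (measurableI _ _ mpv (mfst _ mCE)) mG.
have -> : [set w | ([set zt | B (pval n zt.1 zt.2)] `&`
    [set zt | [set z | C (stat n.+1 z) /\ E (tail_seq n.+1 z)] zt.1])
      (zeta w, tau w n)] =
    [set w | [/\ B (pval n (zeta w) (tau w n)), C (stat n.+1 (zeta w))
                & E (tail_seq n.+1 (zeta w))]].
  by apply/seteqP; split => w /=; [case=> ? []|case].
rewrite present_uniform// => present.
transitivity (U B * (Pr ((@tail_seq _ R n.+1 \o tau) @^-1` G) *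
    P [set z | C (stat n.+1 z) /\ E (tail_seq n.+1 z)])).
  rewrite muleCA -present; congr (Pr _); apply/seteqP.
  by split => w /=; [case=> ? [[? ?] ?]|case=> ? [? ? ?]].
rewrite -cE -future; congr (_ * Pr _); apply/seteqP.
by split => w /=; [case=> ? []|case=> _ [[? ?] ?]].
Qed.

Lemma pval_uniform n (B : set R) : measurable B ->
  Pr [set w | B (pval n (zeta w) (tau w n))] = U B.
Proof.
move=> mB; have := @pval_state_independent n B setT mB measurableT.
by rewrite preimage_setT setIT probability_setT mule1.
Qed.

(** Algebraic transitivity computes each state from the preceding one, and a
    p-value is a function of the state preceding it. The first state is the one
    at time 1, where transitivity starts. *)
Lemma future_pvals_state (B : nat -> set R) k m : (forall i, measurable (B i)) ->
  exists2 D, measurable D & forall w, state m.+1 w \in D <->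
    forall i, (m < i < m.+1 + k)%N -> B i (pval i (zeta w) (tau w i)).
Proof.
move=> mB; elim: k m => [|k IH] m.
  exists setT => // w; split=> [_ i /andP[mi]|_]; last by rewrite inE.
  by rewrite addn0 ltnS leqNgt mi.
have [D mD DE] := IH m.+1; have [F FE] := S_ATTS.1.
have [mF {}FE] := FE m.+1 isT.
pose X := ((Sigma m.+1 * seqspace Z) * seqspace R)%type.
have my : measurable_fun setT (fun x : X => (x.1.1, x.1.2 0%N)).
  apply: measurable_fun_pair; first exact: measurableT_comp.
  exact: (measurableT_comp (@measurable_coordinate _ Z 0%N)
    (measurableT_comp measurable_snd measurable_fst)).
pose nexty (x : X) := F m.+1 (x.1.1, x.1.2 0%N).
have mnexty : measurable_fun setT nexty by exact: (measurableT_comp mF my).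
pose nextstate (x : X) := ((nexty x, tail_seq 1 x.1.2), tail_seq 1 x.2).
have mnext : measurable_fun setT nextstate.
  apply: measurable_fun_pair; last first.
    exact: (measurableT_comp (@measurable_tail_seq _ R 1) measurable_snd).
  apply: measurable_fun_pair => //.
  exact: (measurableT_comp (@measurable_tail_seq _ Z 1)
    (measurableT_comp measurable_snd measurable_fst)).
pose nextp (x : X) := kernel_tail (K m.+2) (@score m.+1)
  ((nexty x, A (x.1.1, x.1.2 0%N)), x.2 0%N).
have mnextp : measurable_fun setT nextp.
  have mA : measurable_fun setT (fun x : X => A (x.1.1, x.1.2 0%N)).
    exact: (measurableT_comp (@A_ncm m.+1) my).
  have mt : measurable_fun setT (fun x : X => x.2 0%N).
    exact: (measurableT_comp (@measurable_coordinate _ R 0%N) measurable_snd).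
  exact: (measurableT_comp (measurable_kernel_tail (K m.+2) (@measurable_score m.+1))
    (measurable_fun_pair (measurable_fun_pair mnexty mA) mt)).
have nextyE w : nexty (state m.+1 w) = stat m.+2 (zeta w).
  by rewrite /nexty /state /= tail_seq0 /stat (init_segS m.+1) FE.
have nextstateE w : nextstate (state m.+1 w) = state m.+2 w.
  by rewrite /nextstate nextyE /state /= !tail_seqS.
have nextpE w : nextp (state m.+1 w) = pval m.+1 (zeta w) (tau w m.+1).
  rewrite /nextp nextyE /state /= !tail_seq0 pvalE.
  by rewrite /score /nonconformity_score butlast_init_seg last_init_seg.
exists (nextp @^-1` B m.+1 `&` nextstate @^-1` D).
  by apply: measurableI; rewrite -[Y in measurable Y]setTI;
    [exact: mnextp|exact: mnext].
move=> w; rewrite inE /= nextpE nextstateE; split.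
  move=> [Bw /mem_set /DE Dw] i /andP[mi imk].
  have [<-//|im] := eqVneq m.+1 i; apply: Dw.
  by rewrite ltn_neqAle im mi/= addSnnS.
move=> Bw; split; first by apply: Bw; rewrite ltnSn/= addnS ltnS leq_addr.
apply/set_mem/DE => i /andP[mi imk]; apply: Bw.
by rewrite (ltnW mi)/= -addSnnS.
Qed.

(** The earliest p-value is independent of the remaining ones, as these form an
    event of the state that follows it. *)
Lemma pvals_block (B : nat -> set R) k m : (forall i, measurable (B i)) ->
  Pr [set w | forall i, (m <= i < m + k)%N -> B i (pval i (zeta w) (tau w i))] =
  \prod_(m <= i < m + k) U (B i).
Proof.
move=> mB; elim: k m => [|k IH] m.
  rewrite addn0 big_geq// (_ : [set _ | _] = setT) ?probability_setT//.
  by apply/seteqP; split => // w _ i /andP[mi]; rewrite ltnNge mi.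
have [D mD DE] := future_pvals_state k m mB.
have stateD : state m.+1 @^-1` D =
    [set w | forall i, (m < i < m.+1 + k)%N -> B i (pval i (zeta w) (tau w i))].
  apply/seteqP; split => w; first by move=> /mem_set /DE.
  by move=> /DE /set_mem.
rewrite big_ltn; last by rewrite addnS ltnS leq_addr.
rewrite -addSnnS -IH -stateD -(@pval_state_independent m _ _ (mB m) mD) stateD.
congr (Pr _); apply/seteqP; split => w /=.
  move=> Bw; split; first by apply: Bw; rewrite leqnn addSn ltnS leq_addr.
  by move=> i /andP[mi imk]; apply: Bw; rewrite (ltnW mi).
move=> [Bm Bw] i /andP[mi imk]; have [<-//|im] := eqVneq m i; apply: Bw.
by rewrite ltn_neqAle im mi.
Qed.

Lemma pvals_Uinfty :
  Uinfty_distributed Pr (fun w n => pvalue S A K (init_seg n.+1 (zeta w)) (tau w n)).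
Proof.
split=> [n|].
  by split; [exact: measurable_pval_Omega|exact: pval_uniform].
apply: prefix_mutually_independent => N B mB.
have := pvals_block N 0 mB; rewrite add0n big_mkord => ->.
by apply: eq_bigr => i _; rewrite -(@pval_uniform i _ (mB i)).
Qed.

End online_compression.

Theorem theorem1 (R : realType) (d : measure_display) (Z : measurableType d)
  (Z_luzin : luzin R Z)
  (dS : nat -> measure_display) (Sigma : forall n, measurableType (dS n))
  (S : forall n, n.-tuple Z -> Sigma n) (S_stat : statistics S)
  (Pm : set (probability (seqspace Z) R)) (S_ATTS : ATTS Pm S)
  (K : forall n, R.-pker (Sigma n) ~> (n.-tuple Z))
  (K_cond : common_cond_distr Pm S K)
  (A : forall n, Sigma n * Z -> R) (A_ncm : nonconformity_measure A)
  (P : probability (seqspace Z) R) (P_Pm : Pm P)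
  (d' : measure_display) (Omega : measurableType d') (Pr : probability Omega R)
  (zeta : Omega -> seqspace Z) (zeta_law : has_law Pr zeta P)
  (tau : Omega -> seqspace R) (tau_law : Uinfty_distributed Pr tau)
  (zeta_tau : independent2 Pr zeta tau) :
  Uinfty_distributed Pr
    (fun w n => pvalue S A K (init_seg n.+1 (zeta w)) (tau w n)).
Proof.
exact: (pvals_Uinfty S_stat S_ATTS K_cond A_ncm P_Pm zeta_law tau_law zeta_tau).
Qed.
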